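(* Let $(X,R)$ be a Yang-Baxter set, i.e. a set $X$ with a set-theoretic Yang-Baxter operator $R:X\times X\to X\times X$. Let $(C^{YB}_*(X),\partial^A_* )$ be its ''algebraic'' Yang-Baxter chain complex and $(C^{YB}_*(X),\partial^G_* )$ its ''graphic'' Yang-Baxter chain complex. Then the ''algebraic'' and ''graphic'' Yang-Baxter homologies coincide: $H^A_n\cong H^G_n$ for all $n$. More generally, the chain complexes $(C^{YB}_*(X),\partial^A_* )$ and $(C^{YB}_*(X),\partial^G_* )$ are isomorphic.
   Context: A set-theoretic Yang-Baxter operator on a set $X$ is an invertible function $R:X\times X\to X\times X$ satisfying $(R\times \mathrm{Id}_X)\circ(\mathrm{Id}_X\times R)\circ(R\times \mathrm{Id}_X)=(\mathrm{Id}_X\times R)\circ(R\times \mathrm{Id}_X)\circ(\mathrm{Id}_X\times R)$. Write $R(x,y)=(R_1(x,y),R_2(x,y))$. Chain groups (the same for both complexes): $C^{YB}_n(X)=\mathbb{Z}X^n$ is the free abelian group generated by $n$-tuples $(x_1,\dots,x_n)$ of elements of $X$. ''Algebraic'' boundary. Let $\mathcal I_n$ be the $n$-cube $I^n=I_1\times\cdots\times I_n$, $I=[0,1]$, regarded as a cubical complex, with faces oriented by the order of the coordinate axes. A face is given by fixing some coordinates to values $\epsilon_k\in\{0,1\}$ and leaving the other coordinates free. A Yang-Baxter coloring of $\mathcal I_n$ by $(X,R)$ is a map $L$ from the set of edges of $\mathcal I_n$ to $X$ such that for every 2-face, with free coordinates $i<j$ (all other coordinates fixed to values $\epsilon_k$),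 if the edge with free $i$-th coordinate and $j$-th coordinate $0$ has color $x$, and the edge with $i$-th coordinate $1$ and free $j$-th coordinate has color $y$, then the edge with $i$-th coordinate $0$ and free $j$-th coordinate has color $R_1(x,y)$ and the edge with free $i$-th coordinate and $j$-th coordinate $1$ has color $R_2(x,y)$. The initial path of $\mathcal I_n$ is the sequence of edges $(e_1,\dots,e_n)$ with $e_i=1_1\times\cdots\times 1_{i-1}\times I_i\times 0_{i+1}\times\cdots\times 0_n$. It is a known fact (Carter, Elhamdadi, Saito) that for every $(x_1,\dots,x_n)\in X^n$ there is a unique Yang-Baxter coloring $L$ of $\mathcal I_n$ with $L(e_i)=x_i$ for all $i$. Given this coloring, each $k$-face $\mathcal J$ with free coordinates $j_1<\dots<j_k$ has an induced initial path, whose $m$-th edge is the edge of $\mathcal J$ with coordinates $j_1,\dots,j_{m-1}$ equal to $1$, coordinate $j_m$ free, and coordinates $j_{m+1},\dots,j_k$ equal to $0$; let $L(\mathcal J)\in X^k$ be the $k$-tuple of colors of the edges of this path. The cubical boundary is $\partial^C_n(\mathcal I_n)=\sum_{i=1}^{2n}\epsilon_i\mathcal J_i$, the sum over all $(n-1)$-faces $\mathcal J_i$, where $\epsilon_i=\pm1$ according to whether the orientation of $\mathcal J_i$ given by the order of its free coordinates agrees with the induced orientation or not; the induced orientation of an $(n-1)$-face is the one for which an oriented basis of the face followed (in last position) by the inward pointing normal agrees with the standard orientation of the $n$-cube. Define the homomorphism $\partial^A_n:C^{YB}_n(X)\to C^{YB}_{n-1}(X)$ by $\partial^A_n(x_1,\dots,x_n)=\sum_{i=1}^{2n}\epsilon_i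 L(\mathcal J_i)$, where $L$ is the coloring determined by $(x_1,\dots,x_n)$. One has $\partial^A_{n-1}\circ\partial^A_n=0$, and $H^A_n=\ker\partial^A_n/\mathrm{im}\,\partial^A_{n+1}$. ''Graphic'' boundary. For $1\le j\le n-1$ let $R_{(j)}:X^n\to X^n$ apply $R$ to the coordinates in positions $j,j+1$ and leave the other coordinates unchanged. For $1\le i\le n$, define $d^l_{i,n}:X^n\to X^{n-1}$ as follows: apply $R_{(i-1)}$, then $R_{(i-2)}$, and so on, ending with $R_{(1)}$ (nothing is applied if $i=1$), and then delete the first coordinate. Define $d^r_{i,n}:X^n\to X^{n-1}$ as follows: apply $R_{(i)}$, then $R_{(i+1)}$, and so on, ending with $R_{(n-1)}$ (nothing is applied if $i=n$), and then delete the last coordinate. Extend both linearly, and set $\partial^G_n=\sum_{i=1}^n(-1)^i(d^l_{i,n}-d^r_{i,n}):C^{YB}_n(X)\to C^{YB}_{n-1}(X)$. One has $\partial^G_{n-1}\circ\partial^G_n=0$, and $H^G_n=\ker\partial^G_n/\mathrm{im}\,\partial^G_{n+1}$. *)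

(* Defs.v *)
From HB Require Import structures.
From mathcomp Require Import all_boot all_order all_algebra.
From mathcomp Require Import ring_quotient.
From mathcomp Require Import boolp classical_sets.
From mathcomp Require Import freeg.

Set Implicit Arguments.
Unset Strict Implicit.
Unset Printing Implicit Defensive.

Import Order.TTheory GRing.Theory Num.Theory.
Local Open Scope ring_scope.

(** * Homology and isomorphisms

    A sequence of groups and maps is indexed so that [d n] is the differential
    [C_n -> C_(n-1)].  For [n = 0] the codomain is [C 0] since [0.-1 = 0]; the
    two differentials below are empty sums there, hence zero, and so every
    [0]-chain is a cycle. *)

Section Homology.
Variables (C : nat -> zmodType) (d : forall n, {additive C n -> C n.-1}).
Variable n : nat.

Definition cycle_pred : {pred C n} := fun c => d n c == 0.

Fact cycle_zmod_closed : zmod_closed cycle_pred.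
Proof.
split=> [|a b]; rewrite !unfold_in ?raddf0 //.
by move=> /eqP da /eqP db; rewrite raddfB da db subrr.
Qed.

HB.instance Definition _ :=
  GRing.isZmodClosed.Build (C n) cycle_pred cycle_zmod_closed.

Record cycles := Cycle { cycle_val :> C n; _ : cycle_val \in cycle_pred }.

HB.instance Definition _ := [isSub for cycle_val].
HB.instance Definition _ := [Choice of cycles by <:].
HB.instance Definition _ := [SubChoice_isSubZmodule of cycles by <:].

(** The image of [d n.+1] as a subgroup of the cycles; [d n \o d n.+1 = 0] is
    not needed to form the quotient. *)
Definition boundary_pred : {pred cycles} :=
  fun z => `[< exists c : C n.+1, d n.+1 c = cycle_val z >].

Fact boundary_zmod_closed : zmod_closed boundary_pred.
Proof.
split=> [|a b]; rewrite !unfold_in; first by apply/asboolP; exists 0; rewrite raddf0.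
move=> /asboolP[u du] /asboolP[v dv]; apply/asboolP; exists (u - v).
by rewrite raddfB du dv.
Qed.

HB.instance Definition _ :=
  GRing.isZmodClosed.Build cycles boundary_pred boundary_zmod_closed.

Definition homology : zmodType := {ideal_quot boundary_pred}.

End Homology.

Definition group_isomorphic (G H : zmodType) : Prop :=
  exists f : {additive G -> H}, bijective f.

Definition complex_isomorphic (C D : nat -> zmodType)
    (dC : forall n, {additive C n -> C n.-1})
    (dD : forall n, {additive D n -> D n.-1}) : Prop :=
  exists f : forall n, {additive C n -> D n},
    (forall n, bijective (f n)) /\
    (forall n (c : C n), f n.-1 (dC n c) = dD n (f n c)).

(** * Yang-Baxter operators and chain groups *)

Section YangBaxter.
Variables (X : Type) (R : X * X -> X * X).

Definition R_Id (t : X * X * X) : X * X * X := (R t.1, t.2).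

Definition Id_R (t : X * X * X) : X * X * X :=
  let p := R (t.1.2, t.2) in (t.1.1, p.1, p.2).

Definition yang_baxter_operator : Prop :=
  bijective R /\ (R_Id \o Id_R \o R_Id =1 Id_R \o R_Id \o Id_R).

End YangBaxter.

(** [{classic _}] only equips the bare type of tuples with the decidable
    equality and choice that [freeg] requires. *)
Definition chain (X : Type) (n : nat) : lmodType int :=
  {freeg {classic n.-tuple X} / int}.

Definition chain_zmod (X : Type) (n : nat) : zmodType := chain X n.

Definition chain_gen (X : Type) n (t : n.-tuple X) : chain X n :=
  << (t : {classic n.-tuple X}) >>.

Section LinearExtension.
Variables (X : Type) (m n : nat) (f : m.-tuple X -> chain X n).

Definition chain_ext (c : chain_zmod X m) : chain_zmod X n :=
  fglift (f : {classic m.-tuple X} -> chain X n) c.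

Fact chain_ext_is_zmod_morphism : zmod_morphism chain_ext.
Proof. exact: lift_is_additive. Qed.

HB.instance Definition _ := GRing.isZmodMorphism.Build
  (chain_zmod X m) (chain_zmod X n) chain_ext chain_ext_is_zmod_morphism.

End LinearExtension.

(** * Faces of the cube *)

Section Cube.
Variable n : nat.

(** [J k = None] when the [k]-th coordinate is free on [J], and
    [J k = Some e] when it is fixed to [e] ([false] is 0, [true] is 1). *)
Definition face := {ffun 'I_n -> option bool}.

Definition free (J : face) : {set 'I_n} := [set k | J k == None].

Record edge := Edge {
  edge_dir : 'I_n;
  edge_face : face;
  edge_free : free edge_face == [set edge_dir]%SET }.

Fact edge_at_subproof (i : 'I_n) (v : 'I_n -> bool) :
  free [ffun k => if k == i then None else Some (v k)] == [set i]%SET.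
Proof. by apply/eqP/setP => k; rewrite !inE ffunE; case: (k == i). Qed.

(** The edge in direction [i] whose other coordinates are given by [v]; the
    value [v i] is irrelevant. *)
Definition edge_at (i : 'I_n) (v : 'I_n -> bool) : edge :=
  Edge (edge_at_subproof i v).

Definition cube_face : face := [ffun=> None].

(** The edge in the free direction [j] of the initial path of [J]. *)
Definition path_edge (J : face) (j : 'I_n) : edge :=
  edge_at j (fun k => if J k is Some e then e else (k < j)%N).

Definition facet (i : 'I_n) (e : bool) : face :=
  [ffun k => if k == i then Some e else None].

Fact card_free_facet i e : #|free (facet i e)| = n.-1.
Proof.
rewrite -[in RHS](card_ord n) -(cardsC1 i); apply: eq_card => k.
by rewrite !inE ffunE; case: (k == i).
Qed.

(** The inward normal is [e_i] on the facet [x_i = 0] and [- e_i] on the facet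
    [x_i = 1]. *)
Definition inward_normal (i : 'I_n) (e : bool) : 'rV[int]_n :=
  (if e then -1 else 1) *: delta_mx 0 i.

(** Rows: the ordered basis of the facet, then the inward normal. *)
Definition facet_frame (i : 'I_n) (e : bool) : 'M[int]_n :=
  \matrix_(k < n)
    nth 0 (rcons [seq delta_mx 0 j | j <- enum (free (facet i e))]
                 (inward_normal i e)) k.

Definition facet_sign (i : 'I_n) (e : bool) : int :=
  if 0 < \det (facet_frame i e) then 1 else -1.

End Cube.

(** * The algebraic differential *)

Section Algebraic.
Variables (X : Type) (R : X * X -> X * X).

Section Coloring.
Variable n : nat.

(** On the 2-face with free coordinates [i < j] and the other coordinates given
    by [v], [free_i b] is the edge in direction [i] with [j]-th coordinate [b],
    and symmetrically for [free_j]. *)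
Definition yb_coloring (L : edge n -> X) : Prop :=
  forall (i j : 'I_n) (v : 'I_n -> bool), (i < j)%N ->
    let free_i b := edge_at i (fun k => if k == j then b else v k) in
    let free_j b := edge_at j (fun k => if k == i then b else v k) in
    R (L (free_i false), L (free_j true)) =
      (L (free_j false), L (free_i true)).

(** The coloring extending [x] along the initial path of the cube.  For a
    Yang-Baxter operator it exists and is unique; the default value is
    irrelevant. *)
Definition coloring_of (x : n.-tuple X) : edge n -> X :=
  xget ((fun e => tnth x (edge_dir e)) : {classic edge n -> X})
    [set L | yb_coloring L /\
             forall i : 'I_n, L (path_edge (cube_face n) i) = tnth x i]%classic.

Definition face_color (L : edge n -> X) (J : face n) : #|free J|.-tuple X :=
  [tuple of [seq L (path_edge J j) | j <- enum_tuple (free J)]].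

Definition facet_color (x : n.-tuple X) (i : 'I_n) (e : bool) : n.-1.-tuple X :=
  tcast (card_free_facet i e) (face_color (coloring_of x) (facet i e)).

End Coloring.

Definition dA (n : nat) : {additive chain_zmod X n -> chain_zmod X n.-1} :=
  chain_ext (fun x : n.-tuple X =>
    \sum_(i < n) \sum_(e : bool)
      facet_sign i e *: chain_gen (facet_color x i e)).

End Algebraic.

(** * The graphic differential

    Positions are numbered from 0: [apply_at j] is the map [R_(j+1)] of the
    usual numbering from 1, and [dl i], [dr i] are [d^l_(i+1)], [d^r_(i+1)]. *)

Section Graphic.
Variables (X : Type) (R : X * X -> X * X).

Fixpoint apply_at_seq (j : nat) (s : seq X) : seq X :=
  match j, s with
  | 0, x :: y :: s' => (R (x, y)).1 :: (R (x, y)).2 :: s'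
  | j'.+1, x :: s' => x :: apply_at_seq j' s'
  | _, _ => s
  end.

Fact size_apply_at_seq j s : size (apply_at_seq j s) = size s.
Proof. by elim: j s => [|j IHj] [|x [|y s]] //=; rewrite IHj. Qed.

Section Faces.
Variable n : nat.

Fact apply_at_subproof j (t : n.-tuple X) : size (apply_at_seq j t) == n.
Proof. by rewrite size_apply_at_seq size_tuple. Qed.

Definition apply_at (t : n.-tuple X) (j : nat) : n.-tuple X :=
  Tuple (apply_at_subproof j t).

Definition delete_last (t : n.-tuple X) : n.-1.-tuple X :=
  [tuple tnth t (widen_ord (leq_pred n) k) | k < n.-1].

Definition dl (i : 'I_n) (t : n.-tuple X) : n.-1.-tuple X :=
  [tuple of behead (foldl apply_at t (rev (iota 0 i)))].

Definition dr (i : 'I_n) (t : n.-tuple X) : n.-1.-tuple X :=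
  delete_last (foldl apply_at t (iota i (n.-1 - i))).

End Faces.

Definition dG (n : nat) : {additive chain_zmod X n -> chain_zmod X n.-1} :=
  chain_ext (fun x : n.-tuple X =>
    \sum_(i < n) (-1) ^+ i.+1 *: (chain_gen (dl i x) - chain_gen (dr i x))).

End Graphic.

(* Main.v *)
(** On the face [x_i = 1], the edges of the induced initial path before
    position [i] arise by dragging the [i]-th edge of the initial path of the
    cube leftwards across its predecessors; each crossing is a 2-face, hence an
    application of [R], so the face is coloured by [d^l_i].  Likewise the face
    [x_i = 0] is coloured by [d^r_i], dragging that edge rightwards.  The
    determinant giving the sign of the face contributes [(-1)^(n-i)] up to the
    side, so the two differentials agree up to [(-1)^(n-1)] in degree [n], and
    scaling degree [n] by [(-1)^C(n,2)] is an isomorphism of complexes.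

    The Yang-Baxter equation enters through the existence of the colouring: it
    makes the restrictions to the faces [x_i = 0] and [x_i = 1] commute.  The
    colour of an edge can then be computed by restricting one coordinate after
    the other. *)

Require Import Defs.
From mathcomp Require Import all_boot all_order all_algebra.
From HB Require Import structures.
From mathcomp Require Import ring_quotient boolp classical_sets.
From mathcomp Require freeg.

Set Implicit Arguments.
Unset Strict Implicit.
Unset Printing Implicit Defensive.

Import GRing.Theory Num.Theory.
Local Open Scope ring_scope.
Local Open Scope quotient_scope.

(** * Existence of the colouring of the cube *)

Section ColoringExists.
Variables (X : Type) (R : X * X -> X * X).

(** The colours of the initial path of the face [x_1 = 0] when those of the
    initial path of the cube are [x :: s]. *)
Fixpoint push (x : X) (s : seq X) : seq X :=
  if s is y :: s' then (R (x, y)).1 :: push (R (x, y)).2 s' else [::].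

Lemma size_push x s : size (push x s) = size s.
Proof. by elim: s x => //= y s IHs x; rewrite IHs. Qed.

(** The colour of the edge in the first direction whose other coordinates are
    [v], when the initial path is coloured by [x :: s]: the second coordinate is
    eliminated first, by restricting to the face where it is [0] or [1]. *)
Fixpoint head_color (v : seq bool) (x : X) (s : seq X) : X :=
  match v, s with
  | b :: v', y :: s' =>
      if b then head_color v' (R (x, y)).2 s' else head_color v' x (push y s')
  | _, _ => x
  end.

(** Coordinates before the direction [i] are eliminated in increasing order; the entry of [v] at [i]
    itself is ignored. *)
Fixpoint edge_color (x0 : X) (i : nat) (v : seq bool) (s : seq X) : X :=
  match i, v, s with
  | 0, _ :: v', x :: s' => head_color v' x s'
  | i'.+1, b :: v', x :: s' => edge_color x0 i' v' (if b then s' else push x s')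
  | _, _, _ => x0
  end.

Hypothesis ybR : R_Id R \o Id_R R \o R_Id R =1 Id_R R \o R_Id R \o Id_R R.

Lemma yang_baxterE x y z :
  [/\ (R ((R (x, y)).1, (R ((R (x, y)).2, z)).1)).1 = (R (x, (R (y, z)).1)).1,
      (R ((R (x, y)).1, (R ((R (x, y)).2, z)).1)).2 =
        (R ((R (x, (R (y, z)).1)).2, (R (y, z)).2)).1 &
      (R ((R (x, y)).2, z)).2 = (R ((R (x, (R (y, z)).1)).2, (R (y, z)).2)).2].
Proof. by have := ybR (x, y, z); rewrite /R_Id /Id_R /= => -[-> ->]. Qed.

(** Restrictions to the faces where the first and the second coordinate are 0 commute; each entry of
    [s] costs one Yang-Baxter equation. *)
Lemma push_push x y s :
  push x (push y s) = push (R (x, y)).1 (push (R (x, y)).2 s).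
Proof.
elim: s x y => //= z s IHs x y.
by have [-> -> ->] := yang_baxterE x y z; rewrite IHs.
Qed.

(** This is the colouring rule in the first two directions. Restricting a further coordinate to 0
    uses [push_push]; restricting it to 1 uses the last two components of the Yang-Baxter
    equation. *)
Lemma head_color_crossing v x y s : size v = size s ->
  R (head_color v x (push y s), head_color v y s) =
  (head_color v (R (x, y)).1 (push (R (x, y)).2 s), head_color v (R (x, y)).2 s).
Proof.
elim: v s x y => [|b v IHv] [|z s] x y //=; first by rewrite -surjective_pairing.
move=> [sz]; have [e1 e2 e3] := yang_baxterE x y z.
case: b; last by rewrite -push_push IHv ?size_push // push_push.
by rewrite IHv // -e2 -e3.
Qed.

Lemma edge_color_crossing x0 i j v s : (i < j < size v)%N -> size v = size s ->
  R (edge_color x0 i (set_nth false v j false) s,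
     edge_color x0 j (set_nth false v i true) s) =
  (edge_color x0 j (set_nth false v i false) s,
   edge_color x0 i (set_nth false v j true) s).
Proof.
elim: i j v s => [|i IHi] [|j] [|b v] [|x s] //=;
  rewrite ?ltn0 ?andbF // !ltnS => ij [sz]; last first.
  by rewrite IHi //; case: (b); rewrite ?size_push.
(* The coordinates strictly between the two directions are eliminated next; [push_push] handles a
   restriction to 0. *)
elim: j v s x ij sz => [|j IHj] [|c v] [|y s] //= x ij [sz].
  exact: head_color_crossing.
by case: c; rewrite IHj ?size_push // push_push.
Qed.

(** Coordinates before [i] are 1 and strip entries from the front; later ones are 0 and leave the
    head colour unchanged. *)
Lemma edge_color_initial x0 i n s : (i < n)%N -> size s = n ->
  edge_color x0 i (mkseq (fun k => k < i)%N n) s = nth x0 s i.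
Proof.
elim: i n s => [|i IHi] [|n] [|x s] //= ltin [sz].
  elim: n s {ltin} sz 1%N => [|n IHn] [|y s] //= [sz] m.
  by rewrite -[RHS](IHn (push y s) _ m.+1) ?size_push.
rewrite -(IHi n) // /mkseq -(addn0 1%N) iotaDl -map_comp.
by congr edge_color; apply: eq_map => k /=.
Qed.

(** The bit in the direction of [e] itself is [false]. *)
Definition edge_bits n (e : edge n) : seq bool :=
  [seq edge_face e k == Some true | k <- enum 'I_n].

Lemma size_edge_bits n (e : edge n) : size (edge_bits e) = n.
Proof. by rewrite size_map size_enum_ord. Qed.

Lemma nth_edge_bits n (e : edge n) (k : 'I_n) :
  nth false (edge_bits e) k = (edge_face e k == Some true).
Proof. by rewrite (nth_map k) ?size_enum_ord // nth_ord_enum. Qed.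

Lemma edge_bits_set n (i j : 'I_n) (b : bool) (v : 'I_n -> bool) : i != j ->
  edge_bits (edge_at i (fun k => if k == j then b else v k)) =
  set_nth false [seq [&& k != i, k != j & v k] | k <- enum 'I_n] j b.
Proof.
move=> nij; apply: (@eq_from_nth _ false).
  by rewrite size_edge_bits size_set_nth size_map size_enum_ord (maxn_idPr _).
rewrite size_edge_bits => k ltkn; rewrite -[k]/(val (Ordinal ltkn)).
move: (Ordinal _) => {ltkn}k.
rewrite nth_edge_bits nth_set_nth /= (nth_map k) ?size_enum_ord // nth_ord_enum.
rewrite ffunE (inj_eq val_inj); have [->|_] := eqVneq k i.
  by rewrite (negPf nij).
by case: (k == j); case: b; case: (v k).
Qed.

Lemma coloring_exists n (x : n.-tuple X) : exists L : edge n -> X,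
  yb_coloring R L /\ forall i : 'I_n, L (path_edge (cube_face n) i) = tnth x i.
Proof.
(* The 0-cube has no edges, and its empty tuple supplies no default colour. *)
case: n x => [|n] x; first by exists (tnth x \o @edge_dir 0); split=> -[].
exists (fun e => edge_color (thead x) (edge_dir e) (edge_bits e) x).
split=> [i j v ltij|i] /=.
  have nij : i != j by rewrite neq_ltn ltij.
  have nji : j != i by rewrite eq_sym.
  rewrite !edge_bits_set //.
  have -> : [seq [&& k != j, k != i & v k] | k <- enum 'I_n.+1] =
            [seq [&& k != i, k != j & v k] | k <- enum 'I_n.+1].
    by apply: eq_map => k; rewrite andbCA.
  by rewrite edge_color_crossing // ?ltij size_map size_enum_ord ?size_tuple /=.
rewrite [RHS](tnth_nth (thead x)) -(@edge_color_initial _ _ n.+1) ?size_tuple //.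
congr edge_color; apply: (@eq_from_nth _ false) => [|k].
  by rewrite size_edge_bits size_mkseq.
rewrite size_edge_bits => ltkn; rewrite nth_mkseq // -[k]/(val (Ordinal ltkn)).
rewrite nth_edge_bits !ffunE -val_eqE /=.
by case: ltngtP.
Qed.

End ColoringExists.

(** * Edge paths raising one coordinate at a time *)

Section Paths.
Variables (X : Type) (R : X * X -> X * X) (n : nat) (L : edge n -> X).

Lemma edge_at_eq (i : 'I_n) (u v : 'I_n -> bool) :
  (forall k, k != i -> u k = v k) -> edge_at i u = edge_at i v.
Proof.
move=> uv; rewrite /edge_at; move: (edge_at_subproof i v).
have -> : [ffun k => if k == i then None else Some (v k)] =
          [ffun k => if k == i then None else Some (u k)] :> face n.
  by apply/ffunP => k; rewrite !ffunE; case: eqVneq => // /uv ->.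
by move=> p; congr Edge; apply: bool_irrelevance.
Qed.

(** The colours along the edge path that starts at the vertex [v] and raises the
    coordinates listed in [w] one after the other. *)
Fixpoint path_color (v : 'I_n -> bool) (w : seq 'I_n) : seq X :=
  if w is i :: w' then
    L (edge_at i v) :: path_color (fun k => (k == i) || v k) w'
  else [::].

Lemma size_path_color v w : size (path_color v w) = size w.
Proof. by elim: w v => //= i w IHw v; rewrite IHw. Qed.

Lemma path_color_cat v u w : path_color v (u ++ w) =
  path_color v u ++ path_color (fun k => (k \in u) || v k) w.
Proof.
elim: u v => //= i u IHu v; rewrite IHu; congr (_ :: _ ++ path_color _ w).
by apply: funext => k; rewrite inE orbA (orbC (k == i)).
Qed.

Lemma path_color_sorted v w : pairwise (fun i j : 'I_n => i < j)%N w ->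
  path_color v w =
  [seq L (edge_at j (fun k => (k \in w) && (k < j)%N || v k)) | j <- w].
Proof.
elim: w v => //= i w IHw v /andP[/allP iw pw]; congr (_ :: _).
  congr L; apply: edge_at_eq => k nki; rewrite inE (negPf nki) /=.
  by case: (boolP (k \in w)) => //= /iw ik; rewrite ltnNge ltnW.
rewrite IHw //; apply/eq_in_map => j jw; congr L; apply: edge_at_eq => k _.
rewrite inE; case: eqVneq => [->|_] //=.
by rewrite iw // !orbT.
Qed.

Hypothesis ybL : yb_coloring R L.

(** The steps [i], [j] follow two sides of a 2-face, and [R] yields the colours of the other two.
    Both routes end at the same vertex, so the tail [w] keeps its colours. *)
Lemma apply_at_swap v u (i j : 'I_n) w : (i < j)%N -> ~~ v i -> ~~ v j ->
  i \notin u -> j \notin u ->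
  apply_at_seq R (size u) (path_color v (u ++ i :: j :: w)) =
  path_color v (u ++ j :: i :: w).
Proof.
move=> ij; elim: u v => [|k u IHu] v /=; last first.
  move=> vi vj; rewrite !inE !negb_or => /andP[ik iu] /andP[jk ju].
  by rewrite IHu ?negb_or ?ik ?jk.
move=> /negPf vi /negPf vj _ _; have := ybL v ij => /=.
have nij : i != j by rewrite neq_ltn ij.
have -> : edge_at i (fun k => if k == j then false else v k) = edge_at i v.
  by apply: edge_at_eq => k _; case: eqVneq => // ->.
have -> : edge_at j (fun k => if k == i then false else v k) = edge_at j v.
  by apply: edge_at_eq => k _; case: eqVneq => // ->.
have -> : edge_at i (fun k => if k == j then true else v k) =
          edge_at i (fun k => (k == j) || v k) by apply: edge_at_eq.
have -> : edge_at j (fun k => if k == i then true else v k) =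
          edge_at j (fun k => (k == i) || v k) by apply: edge_at_eq.
move=> -> /=; congr [:: _, _ & path_color _ w].
by apply: funext => k; rewrite orbCA.
Qed.

(** The last entry of [u] is crossed first, hence the induction from the right end. *)
Lemma foldl_apply_at_left v u (i : 'I_n) w :
  uniq (rcons u i) -> all (fun k : 'I_n => k < i)%N u ->
  {in rcons u i, forall k, ~~ v k} ->
  foldl (fun s k => apply_at_seq R k s) (path_color v (u ++ i :: w))
    (rev (iota 0 (size u))) = path_color v (i :: u ++ w).
Proof.
elim/last_ind: u w => [|u j IHu] w //.
rewrite all_rcons => un /andP[ji ui] vk.
rewrite size_rcons -addn1 iotaD rev_cat /= add0n cat_rcons.
move: un; rewrite -!cats1 -catA /= cat_uniq /= inE => /and3P[uu].
rewrite orbF !negb_or => /andP[ju iu] /andP[nji _].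
rewrite apply_at_swap //; first last.
- by apply: vk; rewrite mem_rcons !inE eqxx.
- by apply: vk; rewrite mem_rcons !inE mem_rcons !inE eqxx orbT.
rewrite IHu ?rcons_uniq ?iu -?catA //= => k.
rewrite mem_rcons inE => ku; apply: vk.
by rewrite mem_rcons inE mem_rcons inE; case/orP: ku => ->; rewrite ?orbT.
Qed.

Lemma foldl_apply_at_right v u (i : 'I_n) w :
  uniq (u ++ i :: w) -> all (fun k : 'I_n => i < k)%N w ->
  {in i :: w, forall k, ~~ v k} ->
  foldl (fun s k => apply_at_seq R k s) (path_color v (u ++ i :: w))
    (iota (size u) (size w)) = path_color v (u ++ w ++ [:: i]).
Proof.
elim: w u => [|j w IHw] u //= un /andP[ij iw] vk.
move: (un); rewrite -cat_rcons cat_uniq => /and3P[_ /=].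
rewrite !negb_or mem_rcons !inE => /andP[/norP[_ ju] _] _.
move: (un); rewrite cat_uniq /= negb_or => /and3P[_ /andP[iu _] _].
rewrite cat_rcons apply_at_swap //; [|by apply: vk; rewrite !inE eqxx ?orbT..].
rewrite -(cat_rcons j u (i :: w)) -(size_rcons u j) IHw ?cat_rcons //.
  rewrite (perm_uniq (_ : perm_eq _ (u ++ [:: i, j & w]))) //.
  by rewrite perm_cat2l (perm_catCA [:: j] [:: i] w).
move=> k; rewrite !inE => /orP[]; first by move=> ki; apply: vk; rewrite !inE ki.
by move=> kw; apply: vk; rewrite !inE kw !orbT.
Qed.

End Paths.

(** * Colours of the facets *)

Lemma sorted_enum_ord n : pairwise (fun i j : 'I_n => i < j)%N (enum 'I_n).
Proof.
by rewrite -(pairwise_map val ltn) val_enum_ord -(sorted_pairwise ltn_trans)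
           iota_ltn_sorted.
Qed.

Lemma enum_free_facet n (i : 'I_n) e :
  enum (Defs.free (facet i e)) = [seq k <- enum 'I_n | k != i].
Proof.
rewrite {1}/enum_mem -enumT; apply: eq_filter => k.
by rewrite !inE ffunE; case: (k == i).
Qed.

Lemma enum_ord_split n (i : 'I_n) : exists u w : seq 'I_n,
  [/\ enum 'I_n = u ++ i :: w, size u = i, all (fun k : 'I_n => k < i)%N u &
      all (fun k : 'I_n => i < k)%N w].
Proof.
have := index_enum_ord i; have := sorted_enum_ord n; have := enum_uniq 'I_n.
case/splitPr: (mem_enum 'I_n i) => u w.
rewrite cat_uniq /= negb_or => /and3P[_ /andP[iu _] _].
rewrite pairwise_cat allrel_consr /= => /and3P[/andP[ui _] _ /andP[iw _]].
by rewrite index_cat (negPf iu) /= eqxx addn0 => su; exists u, w.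
Qed.

Section FacetColor.
Variables (X : Type) (R : X * X -> X * X) (n : nat).

Lemma val_foldl_apply_at (x : n.-tuple X) s :
  foldl (@apply_at X R n) x s = foldl (fun t k => apply_at_seq R k t) x s :> seq X.
Proof. by elim: s x => //= j s IHs x; rewrite IHs. Qed.

Lemma val_delete_last (x : n.-tuple X) : delete_last x = take n.-1 x :> seq X.
Proof.
case: n x => [|m] x; first by rewrite [x]tuple0 /= enum_ord0.
apply: (@eq_from_nth _ (thead x)) => [|k].
  by rewrite size_tuple size_takel // size_tuple.
rewrite size_tuple => ltkm; rewrite nth_take // -[k]/(val (Ordinal ltkm)).
by rewrite -tnth_nth tnth_mktuple (tnth_nth (thead x)).
Qed.

(** The initial path of a facet is the increasing path from its lowest vertex, where at most
    coordinate [i] is 1. *)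
Lemma face_color_facet (L : edge n -> X) (i : 'I_n) e :
  face_color L (facet i e) =
  path_color L (fun k => e && (k == i)) [seq k <- enum 'I_n | k != i] :> seq X.
Proof.
rewrite path_color_sorted; last exact/pairwise_filter/sorted_enum_ord.
rewrite /face_color /= enum_free_facet; apply/eq_in_map => j.
rewrite mem_filter => /andP[nji _]; congr L; apply: edge_at_eq => k nkj.
rewrite mem_filter mem_enum ffunE andbT; case: eqVneq => [->|] /=.
  by rewrite andbT.
by rewrite andbF orbF.
Qed.

Variables (L : edge n -> X) (x : n.-tuple X).
Hypotheses (ybL : yb_coloring R L)
  (Lx : forall i : 'I_n, L (path_edge (cube_face n) i) = tnth x i).

Lemma path_color_enum : path_color L (fun=> false) (enum 'I_n) = x :> seq X.
Proof.
rewrite path_color_sorted ?sorted_enum_ord // -[in RHS](map_tnth_enum x).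
apply: eq_map => i; rewrite -Lx; congr L; apply: edge_at_eq => k _.
by rewrite mem_enum ffunE orbF.
Qed.

(** With [i] moved to the front, deleting the first edge leaves a path starting where only
    coordinate [i] is 1. *)
Lemma face_color_dl (i : 'I_n) : face_color L (facet i true) = dl R i x :> seq X.
Proof.
have [u [w [ew su ui iw]]] := enum_ord_split i.
have := enum_uniq 'I_n; rewrite ew cat_uniq /= negb_or.
case/and3P=> uu /andP[iu _] /andP[iw' _].
rewrite face_color_facet /dl /= val_foldl_apply_at -path_color_enum ew -su.
rewrite (foldl_apply_at_left ybL) ?rcons_uniq ?iu //=.
rewrite filter_cat /= eqxx !(all_filterP _).
- by congr path_color; apply: funext => k; rewrite orbF.
- by apply: sub_all iw => k; rewrite neq_ltn orbC => ->.
- by apply: sub_all ui => k; rewrite neq_ltn => ->.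
Qed.

(** With [i] moved to the end, the edges before it all keep coordinate [i] at 0. *)
Lemma face_color_dr (i : 'I_n) : face_color L (facet i false) = dr R i x :> seq X.
Proof.
have [u [w [ew su ui iw]]] := enum_ord_split i.
have /(congr1 size) := ew; rewrite size_enum_ord size_cat /= => en.
have sw : (n.-1 - i)%N = size w by rewrite {1}en -su addnS addKn.
have suw : n.-1 = size (u ++ w) by rewrite {1}en size_cat addnS.
rewrite face_color_facet /dr val_delete_last val_foldl_apply_at.
rewrite -path_color_enum sw ew -{1}su.
rewrite (foldl_apply_at_right ybL) //; last by rewrite -ew enum_uniq.
rewrite catA path_color_cat suw -(size_path_color L (fun=> false)) take_size_cat //.
rewrite filter_cat /= eqxx !(all_filterP _) //.
- by apply: sub_all iw => k; rewrite neq_ltn orbC => ->.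
- by apply: sub_all ui => k; rewrite neq_ltn => ->.
Qed.

End FacetColor.

Lemma facet_color_true (X : Type) (R : X * X -> X * X) n (x : n.-tuple X) i :
  yang_baxter_operator R -> facet_color R x i true = dl R i x.
Proof.
case=> _ ybR; apply: val_inj; rewrite /= val_tcast.
(* Existence ensures that the choice in [coloring_of] is a colouring, not the default. *)
have [ybL Lx] := xgetPex ((fun e => tnth x (edge_dir e)) : {classic edge n -> X})
  (coloring_exists ybR x).
exact: face_color_dl.
Qed.

Lemma facet_color_false (X : Type) (R : X * X -> X * X) n (x : n.-tuple X) i :
  yang_baxter_operator R -> facet_color R x i false = dr R i x.
Proof.
case=> _ ybR; apply: val_inj; rewrite /= val_tcast.
have [ybL Lx] := xgetPex ((fun e => tnth x (edge_dir e)) : {classic edge n -> X})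
  (coloring_exists ybR x).
exact: face_color_dr.
Qed.

(** * Orientation signs of the facets *)

Lemma enum_free_facet_lift n (i : 'I_n.+1) e :
  enum (Defs.free (facet i e)) = [seq fintype.lift i k | k <- enum 'I_n].
Proof.
have tr : transitive (fun j k : 'I_n.+1 => j < k)%N.
  by move=> ? ? ?; apply: ltn_trans.
(* Both lists are strictly increasing, so comparing their members suffices. *)
apply: (irr_sorted_eq tr) => [j|||j]; first exact: ltnn.
- rewrite (sorted_pairwise tr) enum_free_facet.
  exact/pairwise_filter/sorted_enum_ord.
- rewrite (sorted_pairwise tr) pairwise_map.
  apply: sub_pairwise (sorted_enum_ord n) => j k /=.
  by rewrite !ltnNge leq_bump2.
rewrite enum_free_facet mem_filter mem_enum andbT.
apply/idP/mapP => [|[k _ ->]]; last by rewrite eq_sym neq_lift.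
by rewrite eq_sym => /unlift_some[k -> _]; exists k; rewrite ?mem_enum.
Qed.

Lemma det_facet_frame n (i : 'I_n.+1) e :
  \det (facet_frame i e) = (-1) ^+ (e + (n + i))%N.
Proof.
have sz : size [seq delta_mx 0 j : 'rV[int]_n.+1 |
                  j <- enum (Defs.free (facet i e))] = n.
  by rewrite size_map -cardE card_free_facet.
(* The last row is the normal, supported in column [i]; deleting that row and column leaves the
   identity matrix. *)
rewrite (expand_det_row _ ord_max) (bigD1 i) //= big1 => [|j nji]; last first.
  rewrite mxE nth_rcons sz ltnn eqxx /inward_normal mxE mxE eqxx /=.
  by rewrite (negPf nji) mulr0 mul0r.
rewrite addr0 mxE nth_rcons sz ltnn eqxx /inward_normal !mxE !eqxx mulr1.
rewrite /cofactor /= (_ : row' _ _ = 1%:M) ?det1 ?mulr1.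
  by rewrite [RHS]exprD; case: e {sz}.
apply/matrixP => k l; rewrite !mxE nth_rcons sz lift_max ltn_ord.
rewrite enum_free_facet_lift -map_comp (nth_map k) ?size_enum_ord //.
by rewrite nth_ord_enum /= mxE eqxx /= (inj_eq (@lift_inj _ i)) eq_sym.
Qed.

Lemma facet_signE n (i : 'I_n.+1) e : facet_sign i e = (-1) ^+ (e + (n + i))%N.
Proof.
by rewrite /facet_sign det_facet_frame -signr_odd; case: odd; rewrite ?expr0 ?expr1.
Qed.

(** * Comparison of the two differentials *)

Lemma chain_ext_scale (X : Type) m n (f g : m.-tuple X -> chain X n) (a : int) c :
  (forall x, f x = a *: g x) -> chain_ext f c = (a *: (chain_ext g c : chain X n)).
Proof.
move=> fg; rewrite /chain_ext -(freeg.freeg_repr c) !freeg.fglift_Freeg.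
rewrite /freeg.prelift scaler_sumr; apply: eq_bigr => t _.
by rewrite fg !scalerA mulrC.
Qed.

Lemma dA_dG (X : Type) (R : X * X -> X * X) n (c : chain X n) :
  yang_baxter_operator R -> dA R n c = (-1) ^+ n.-1 *: (dG R n c : chain X n.-1).
Proof.
move=> ybR; apply: chain_ext_scale => x; rewrite scaler_sumr.
(* In degree 0 both sums are empty, so the truncated [n.-1] is harmless. *)
case: n x {c} => [|n] x; first by rewrite !big_ord0.
apply: eq_bigr => i _; rewrite big_bool /= facet_color_true // facet_color_false //.
rewrite !facet_signE add0n add1n [RHS]scalerA -exprD addnS exprS mulN1r.
by rewrite scalerBr !scaleNr opprK.
Qed.

(** * Passage to homology *)

Lemma ideal_quot_isomorphic (A B : zmodType) (I : zmodClosed A)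
    (J : zmodClosed B) (F : {additive A -> B}) :
  bijective F -> (forall z, (F z \in J) = (z \in I)) ->
  group_isomorphic {ideal_quot I} {ideal_quot J}.
Proof.
case=> G FK GK FIJ.
(* Both maps use chosen representatives; [hpi] and [kpi] show independence of the choice. *)
pose h (q : {ideal_quot I}) : {ideal_quot J} := \pi_{ideal_quot J} (F (repr q)).
pose k (q : {ideal_quot J}) : {ideal_quot I} := \pi_{ideal_quot I} (G (repr q)).
have hpi z : h (\pi_{ideal_quot I} z) = \pi_{ideal_quot J} (F z).
  apply/eqP; rewrite -Quotient.idealrBE -raddfB FIJ Quotient.idealrBE.
  by rewrite reprK.
have kpi z : k (\pi_{ideal_quot J} z) = \pi_{ideal_quot I} (G z).
  apply/eqP; rewrite -Quotient.idealrBE -FIJ raddfB !GK Quotient.idealrBE.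
  by rewrite reprK.
have hB : zmod_morphism h.
  move=> a b; rewrite -[a]reprK -[b]reprK -[_ - _]raddfB !hpi.
  by rewrite raddfB [LHS]raddfB.
pose hM := GRing.isZmodMorphism.Build _ _ h hB.
exists (HB.pack h hM : {additive _ -> _}); exists k => q /=.
  by rewrite -[q]reprK hpi kpi FK.
by rewrite -[q]reprK kpi hpi GK.
Qed.

Lemma complex_isomorphic_homology (C D : nat -> zmodType)
    (dC : forall n, {additive C n -> C n.-1})
    (dD : forall n, {additive D n -> D n.-1}) n :
  complex_isomorphic dC dD -> group_isomorphic (homology dC n) (homology dD n).
Proof.
case=> f [fbij fd]; have [g fK gK] := fbij n.
(* The inverse one degree higher pulls bounding chains back. *)
have [g' _ gK'] := fbij n.+1.
have fcyc (c : C n) :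
    (f n c \in cycle_pred dD (n:=n)) = (c \in cycle_pred dC (n:=n)).
  rewrite !unfold_in -fd; apply/eqP/eqP=> [e0|->]; last exact: raddf0.
  by apply: (bij_inj (fbij n.-1)); rewrite raddf0.
have fz (z : cycles dC n) : f n (cycle_val z) \in cycle_pred dD (n:=n).
  by rewrite fcyc (valP z).
have gz (z : cycles dD n) : g (cycle_val z) \in cycle_pred dC (n:=n).
  by rewrite -fcyc gK (valP z).
pose F (z : cycles dC n) : cycles dD n := Cycle (fz z).
have FB : zmod_morphism F by move=> a b; apply: val_inj; rewrite /= raddfB.
pose FM := GRing.isZmodMorphism.Build _ _ F FB.
apply: (@ideal_quot_isomorphic _ _ _ _ (HB.pack F FM : {additive _ -> _})).
  by exists (fun z => Cycle (gz z)) => z; apply: val_inj; rewrite /= ?fK ?gK.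
move=> z; rewrite !unfold_in; apply/asboolP/asboolP => -[c /= dc].
  exists (g' c); apply: (can_inj fK).
  by rewrite (fd n.+1) gK'.
by exists (f n.+1 c); rewrite -(fd n.+1) dc.
Qed.

Theorem theorem3p1 (X : Type) (R : X * X -> X * X)
    (hR : yang_baxter_operator R) :
  (forall n : nat,
     group_isomorphic (homology (dA R) n) (homology (dG R) n)) /\
  complex_isomorphic (dA R) (dG R).
Proof.
suff iso : complex_isomorphic (dA R) (dG R).
  by split=> // n; apply: complex_isomorphic_homology.
(* Passing from degree [n.-1] to [n] raises the exponent by [n.-1], which absorbs the sign in
   [dA_dG]. *)
pose f n : chain X n -> chain X n := *:%R ((-1) ^+ 'C(n, 2)).
exists (fun n => f n : {additive chain_zmod X n -> chain_zmod X n}).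
split=> [n|n c].
  by exists (f n) => c; rewrite /f /= scalerA -expr2 sqrr_sign scale1r.
have -> : dG R n (f n c) = (-1) ^+ 'C(n, 2) *: (dG R n c : chain X n.-1).
  by rewrite /f -signr_odd !scaler_sign; case: odd; rewrite ?raddfN.
rewrite dA_dG // /f /= scalerA -exprD.
suff -> : ('C(n.-1, 2) + n.-1 = 'C(n, 2))%N by [].
by case: n {c} => // n; rewrite binS bin1.
Qed.
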